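(* Let $X_1,X_2,\ldots$ be i.i.d. random variables with $0\le X_i\le 1$ and mean $\mu\in(0,1)$. Let $\varepsilon\in(0,1)$, $\delta\in(0,1)$, let $\delta_1,\delta_2,\ldots$ be positive numbers with $\sum_{\ell=1}^\infty\delta_\ell=\delta$, let $m_1<m_2<\cdots$ be an infinite sequence of positive integers with $\lim_{\ell\to\infty}\frac{\ln\delta_\ell}{m_\ell}=0$, and let $\mathcal N$ be a set of positive integers containing $\{m_1,m_2,\ldots\}$. Let $\overline{X}_n=\frac1n\sum_{i=1}^nX_i$. Let $\mathbf n$ be the smallest $n\in\mathcal N$ such that $\overline{X}_n>0$ and there exists a positive integer $\ell$ with $$M_{\mathrm B}\left(\frac{\overline{X}_n}{1+\varepsilon}\left(1+\frac{n\varepsilon}{n\vee m_\ell}\right),\ \frac{\overline{X}_n}{1+\varepsilon}\right)\le\frac1{m_\ell}\ln\frac{\delta_\ell}{2}.$$ Then such an $n$ exists with probability $1$ (i.e. the sampling process eventually stops almost surely), and $\Pr\{|\overline{X}_{\mathbf n}-\mu|<\varepsilon\mu\}\ge1-\delta$.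
   Context: $a\vee b$ denotes $\max(a,b)$. The function $M_{\mathrm B}$ is defined by: $M_{\mathrm B}(z,\theta)=z\ln\frac{\theta}{z}+(1-z)\ln\frac{1-\theta}{1-z}$ for $z\in(0,1)$, $\theta\in(0,1)$; $M_{\mathrm B}(0,\theta)=\ln(1-\theta)$ and $M_{\mathrm B}(1,\theta)=\ln\theta$ for $\theta\in(0,1)$; $M_{\mathrm B}(z,\theta)=-\infty$ for every real $z$ and $\theta\notin(0,1)$. *)

(* Defs.v *)
From HB Require Import structures.
From mathcomp Require Export all_boot all_order all_algebra.
From mathcomp Require Export all_classical all_reals all_analysis.

Set Implicit Arguments.
Unset Strict Implicit.
Unset Printing Implicit Defensive.

Import Order.TTheory GRing.Theory Num.Theory.
Import numFieldNormedType.Exports.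

Local Open Scope classical_set_scope.
Local Open Scope ring_scope.

(* All infinite sequences are indexed from 0: X i, m l and dl l stand for the
   mathematical X_{i+1}, m_{l+1} and delta_{l+1}. *)

(* The source leaves M_B z t unspecified for t in (0, 1) and z outside [0, 1];
   the value -oo used there is never reached by the stopping rule below, where
   0 < t < z <= 1 because the samples lie in [0, 1]. *)
Definition M_B (R : realType) (z t : R) : \bar R :=
  if ~~ (0 < t < 1) then -oo%E
  else if z == 0 then (ln (1 - t))%:E
  else if z == 1 then (ln t)%:E
  else if 0 < z < 1 then
    (z * ln (t / z) + (1 - z) * ln ((1 - t) / (1 - z)))%:E
  else -oo%E.

Section Sampling.
Variables (d : measure_display) (T : measurableType d) (R : realType).
Variable P : probability T R.

(* Product rule over every finite subfamily. *)
Definition mutually_independent (X : nat -> {RV P >-> R}) : Prop :=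
  forall (s : seq nat) (B : nat -> set R),
    uniq s -> (forall i, measurable (B i)) ->
    P (\bigcap_(i in [set` s]) (X i @^-1` B i)) =
    (\prod_(i <- s) P (X i @^-1` B i))%E.

(* Equality of laws is required on Borel sets only: the value of the
   pushforward on other sets is meaningless. *)
Definition identically_distributed (X : nat -> {RV P >-> R}) : Prop :=
  forall (i j : nat) (B : set R), measurable B ->
    distribution P (X i) B = distribution P (X j) B.

Definition iid (X : nat -> {RV P >-> R}) : Prop :=
  mutually_independent X /\ identically_distributed X.

Definition sample_mean (X : nat -> {RV P >-> R}) (n : nat) (w : T) : R :=
  n%:R^-1 * \sum_(i < n) X i w.

Definition stop_at (X : nat -> {RV P >-> R}) (eps : R) (dl : nat -> R)
    (m : nat -> nat) (N : set nat) (w : T) (n : nat) : Prop :=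
  let Xn := sample_mean X n w in
  [/\ N n, 0 < Xn &
    exists l : nat,
      (M_B (Xn / (1 + eps) * (1 + n%:R * eps / (maxn n (m l))%:R))
           (Xn / (1 + eps))
       <= ((m l)%:R^-1 * ln (dl l / 2))%:E)%E].

(* The value of the stopping time at w is n. *)
Definition stops_first_at (X : nat -> {RV P >-> R}) (eps : R) (dl : nat -> R)
    (m : nat -> nat) (N : set nat) (w : T) (n : nat) : Prop :=
  stop_at X eps dl m N w n /\
  forall k : nat, stop_at X eps dl m N w k -> (n <= k)%N.

End Sampling.

(* Main.v *)
From HB Require Import structures.
From mathcomp Require Import ring lra measurable_realfun.
Require Import Defs.

Import Order.TTheory GRing.Theory Num.Theory.
Import numFieldNormedType.Exports.

Set Implicit Arguments.
Unset Strict Implicit.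
Unset Printing Implicit Defensive.

Local Open Scope classical_set_scope.
Local Open Scope ring_scope.

(**
Write KL(z || t) = - M_B(z, t) and z_n = mu + (n / (n \/ m)) (Xbar_n - mu).
Suppose the rule stops at n through the index l, with m = m_l, although
|Xbar_n - mu| >= eps mu. If Xbar_n >= mu, the pair (z, t) tested by the rule
is a convex combination of (z_n, mu) and (Xbar_n, Xbar_n), so joint convexity
of KL gives KL(z_n || mu) >= KL(z || t) >= ln(2 / delta_l) / m. If
Xbar_n <= mu, the same holds once (z, t) is replaced by its counterpart for
s = Xbar_n / (1 - eps), and this replacement does not decrease KL.

For each side of mu a single tilt lam turns this lower bound into
lam z_n - phi(lam) >= ln(2 / delta_l) / m, up to an arbitrarily small loss, with
phi(lam) = ln(1 - mu + mu e^lam). Then lam S_n - n phi(lam) >= ln(2 / delta_l).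
The process exp(lam S_n - n phi(lam)) is a nonnegative supermartingale, because
e^(lam x) lies below its chord on [0, 1], so by Ville's inequality this happens
for some n with probability at most delta_l / 2. Summing over both sides and
over l bounds the failure probability by delta.

At n = m_l the rule stops as soon as Xbar_n > mu / 2 and l is large, since
KL(x || x / (1 + eps)) >= c x for some c > 0 while ln(2 / delta_l) / m_l tends
to 0; and Xbar_n <= mu / 2 has exponentially small probability.
*)

(** * Bernoulli relative entropy *)

(* At z = 0 and z = 1 the term whose logarithm is a junk value has
   coefficient 0. *)
Definition bern (R : realType) (z t : R) : R :=
  z * ln (t / z) + (1 - z) * ln ((1 - t) / (1 - z)).

Definition bern_cgf (R : realType) (t lam : R) : R :=
  ln (1 - t + t * expR lam).

Section bern.
Variable R : realType.
Implicit Types x z t r b lam eta eps : R.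

Lemma ln_le_sub1 x : 0 < x -> ln x <= x - 1.
Proof. by move=> x0; rewrite -{1}(subrKC 1 x) le_ln1Dx//; lra. Qed.

Lemma mul_ln_div_le z t : 0 <= z -> 0 < t -> z * ln (t / z) <= t - z.
Proof.
rewrite le_eqVlt => /predU1P[<- t0|z0 t0]; first by rewrite mul0r subr0 ltW.
have /(ler_wpM2l (ltW z0)) := ln_le_sub1 (divr_gt0 t0 z0).
suff -> : z * (t / z - 1) = t - z by [].
by field; rewrite gt_eqF.
Qed.

(** The log sum inequality for the pairs (p, r) and (q, q), the second of which contributes ln 1 =
    0. With rho = (p + q) / (r + q), the bound ln y <= y - 1 gives r rho - p for one pair and q rho
    - q for the other, and these sum to 0. *)
Lemma log_sum_le (p q r : R) : 0 <= p -> 0 <= q -> 0 < r ->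
  p * ln (r / p) <= (p + q) * ln ((r + q) / (p + q)).
Proof.
move=> p0 q0 r0.
have [->|qn0] := eqVneq q 0; first by rewrite !addr0.
have {}q0 : 0 < q by rewrite lt_neqAle eq_sym qn0.
have rq : 0 < r + q by rewrite addr_gt0.
have pq : 0 < p + q by rewrite ltr_wpDl.
have -> : (p + q) * ln ((r + q) / (p + q)) =
    - (p * ln ((p + q) / (r + q))) - q * ln ((p + q) / (r + q)).
  by rewrite -[(r + q) / (p + q)]invf_div lnV ?posrE ?divr_gt0//; ring.
have hq : q * ln ((p + q) / (r + q)) <= q * ((p + q) / (r + q) - 1).
  by apply: ler_wpM2l; [exact: ltW|rewrite ln_le_sub1// divr_gt0].
have hp : p * ln (r / p) + p * ln ((p + q) / (r + q)) <=
    r * ((p + q) / (r + q)) - p.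
  have [->|pn0] := eqVneq p 0.
    by rewrite !mul0r addr0 subr0 add0r mulr_ge0 ?divr_ge0 ?ltW.
  have {}p0 : 0 < p by rewrite lt_neqAle eq_sym pn0.
  rewrite -mulrDr -lnM ?posrE ?divr_gt0//.
  have -> : r / p * ((p + q) / (r + q)) = r * ((p + q) / (r + q)) / p.
    by field; rewrite !gt_eqF.
  by apply: mul_ln_div_le; rewrite ?mulr_gt0 ?divr_gt0 ?invr_gt0 ?(ltW p0).
have : r * ((p + q) / (r + q)) - p + q * ((p + q) / (r + q) - 1) = 0.
  by field; rewrite gt_eqF.
lra.
Qed.

Lemma bern_le0 z t : 0 <= z <= 1 -> 0 < t < 1 -> bern z t <= 0.
Proof.
move=> /andP[z0 z1] /andP[t0 t1]; rewrite /bern.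
have := mul_ln_div_le z0 t0.
have : (1 - z) * ln ((1 - t) / (1 - z)) <= (1 - t) - (1 - z).
  by apply: mul_ln_div_le; lra.
lra.
Qed.

(* Joint convexity of the relative entropy, towards a diagonal point (x, x). *)
Lemma bern_mix b x z t : 0 <= b < 1 -> 0 <= x <= 1 -> 0 <= z <= 1 ->
  0 < t < 1 ->
  bern z t <= bern ((1 - b) * z + b * x) ((1 - b) * t + b * x).
Proof.
move=> /andP[b0 b1] /andP[x0 x1] /andP[z0 z1] /andP[t0 t1].
have b1' : 0 < 1 - b by lra.
have scale p r : (1 - b) * p * ln (((1 - b) * r) / ((1 - b) * p)) =
    (1 - b) * (p * ln (r / p)).
  by rewrite -mulf_div divff ?gt_eqF// mul1r mulrA.
have h1 : (1 - b) * z * ln (((1 - b) * t) / ((1 - b) * z)) <=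
    ((1 - b) * z + b * x) *
      ln (((1 - b) * t + b * x) / ((1 - b) * z + b * x)).
  by apply: log_sum_le; rewrite ?mulr_ge0 ?mulr_gt0 ?(ltW b1').
have h2 : (1 - b) * (1 - z) * ln (((1 - b) * (1 - t)) / ((1 - b) * (1 - z))) <=
    ((1 - b) * (1 - z) + b * (1 - x)) *
      ln (((1 - b) * (1 - t) + b * (1 - x)) /
          ((1 - b) * (1 - z) + b * (1 - x))).
  by apply: log_sum_le; rewrite ?mulr_ge0 ?mulr_gt0 ?(ltW b1')//; lra.
rewrite !scale in h1 h2.
have e y : (1 - b) * (1 - y) + b * (1 - x) = 1 - ((1 - b) * y + b * x) by ring.
rewrite !e in h2.
have := bern_le0 (z := z) (t := t); rewrite z0 z1 t0 t1 => /(_ isT isT).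
move=> /(ler_wpM2l b0); rewrite mulr0 /bern.
lra.
Qed.

Lemma bern_sym z t : bern (1 - z) (1 - t) = bern z t.
Proof. by rewrite /bern !subKr addrC. Qed.

Lemma bern_cgf_arg_gt0 t lam : 0 < t < 1 -> 0 < 1 - t + t * expR lam.
Proof.
by move=> /andP[t0 t1]; rewrite addr_gt0 ?subr_gt0// mulr_gt0// expR_gt0.
Qed.

(** Jensen's inequality for a Bernoulli variable of mean t: average the tangent bound ln y <= y - 1
    at y = e^lam / A and y = 1 / A with weights t and 1 - t; the right-hand sides cancel. *)
Lemma bern_cgf_ge t lam : 0 < t < 1 -> lam * t <= bern_cgf t lam.
Proof.
move=> t01; have A0 := bern_cgf_arg_gt0 lam t01.
have /andP[t0 t1] := t01; rewrite /bern_cgf; set A := (1 - t + _) in A0 *.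
have e0 := expR_gt0 lam.
have h1 : t * ln (expR lam / A) <= t * (expR lam / A - 1).
  by apply: ler_wpM2l; [exact: ltW|rewrite ln_le_sub1// divr_gt0].
have h2 : (1 - t) * ln A^-1 <= (1 - t) * (A^-1 - 1).
  by apply: ler_wpM2l; [lra|rewrite ln_le_sub1// invr_gt0].
rewrite ln_div ?posrE// expRK in h1; rewrite lnV ?posrE// in h2.
have : t * (expR lam / A - 1) + (1 - t) * (A^-1 - 1) = 0.
  by rewrite /A; field; rewrite gt_eqF.
lra.
Qed.

Lemma bern_cgfN t lam : 0 < t < 1 ->
  bern_cgf t (- lam) = bern_cgf (1 - t) lam - lam.
Proof.
move=> t01; have t01' : 0 < 1 - t < 1 by lra.
apply/eqP; rewrite eq_sym subr_eq; apply/eqP.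
rewrite /bern_cgf -[X in _ = _ + X]expRK.
rewrite -lnM ?posrE ?expR_gt0 ?bern_cgf_arg_gt0// subKr expRN; congr ln.
by field; rewrite gt_eqF ?expR_gt0.
Qed.

(** The log odds ratio: the maximizer of lam z - phi(lam), at which the tilted Bernoulli law has
    mean z. *)
Definition tilt t z : R := ln (z * (1 - t) / (t * (1 - z))).

Lemma tiltE t z : 0 < t < 1 -> 0 < z < 1 ->
  tilt t z * z - bern_cgf t (tilt t z) = - bern z t.
Proof.
move=> /andP[t0 t1] /andP[z0 z1].
have [t1' z1'] : 0 < 1 - t /\ 0 < 1 - z by lra.
rewrite /bern_cgf /tilt lnK ?posrE; last by rewrite divr_gt0 ?mulr_gt0.
have -> : 1 - t + t * (z * (1 - t) / (t * (1 - z))) = (1 - t) / (1 - z).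
  by field; rewrite !gt_eqF.
by rewrite /bern !ln_div ?posrE ?mulr_gt0// !lnM ?posrE//; ring.
Qed.

Lemma tilt_homo t z z' : 0 < t < 1 -> 0 < z -> z <= z' -> z' < 1 ->
  tilt t z <= tilt t z'.
Proof.
move=> /andP[t0 t1] z0 zz' z1'.
have ? : 0 < 1 - t by lra.
have ? : 0 < 1 - z by lra.
have ? : 0 < 1 - z' by lra.
have ? : 0 < z' by lra.
rewrite /tilt ler_ln ?posrE ?divr_gt0 ?mulr_gt0//.
rewrite ler_pdivrMr ?mulr_gt0// mulrAC ler_pdivlMr ?mulr_gt0//.
rewrite -subr_ge0.
have -> : z' * (1 - t) * (t * (1 - z)) - z * (1 - t) * (t * (1 - z')) =
  t * (1 - t) * (z' - z) by ring.
by apply: mulr_ge0; [rewrite mulr_ge0// ltW|rewrite subr_ge0].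
Qed.

Lemma tilt_ge0 t z : 0 < t < 1 -> t <= z < 1 -> 0 <= tilt t z.
Proof.
move=> /andP[t0 t1] /andP[tz z1].
have ? : 0 < 1 - z by lra.
rewrite /tilt ln_ge0// ler_pdivlMr ?mulr_gt0// mul1r.
lra.
Qed.

(* The supporting line of the entropy at (almost) the lowest point of the
   region serves all of the region at once; the loss eta is spent on an infimum
   that need not be attained and on z = 1, whose tilt is infinite. *)
Lemma upper_tilt t r eta : 0 < t < 1 -> 0 < eta ->
  exists lam, forall z, t <= z <= 1 -> bern z t <= - r ->
    r - eta <= lam * z - bern_cgf t lam.
Proof.
move=> t01 eta0; have /andP[t0 t1] := t01.
pose A := [set z | t <= z <= 1 /\ bern z t <= - r].
have [[z0 [Az0 z01]]|noA] := pselect (exists z, A z /\ z < 1); last first.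
  (* Only z = 1 can lie in the region; this lam solves lam - phi(lam) = - ln t - eta. *)
  exists (ln ((1 - t) / (t * (expR eta - 1)))) => z /andP[tz z1] hz.
  have ez : z = 1.
    apply: contrapT => zn1; apply: noA; exists z; split => //.
      by split => //; rewrite tz.
    by rewrite lt_neqAle z1 andbT; exact/eqP.
  have e1 : 1 < expR eta by rewrite expR_gt1.
  have e1' : 0 < expR eta - 1 by lra.
  have t1' : 0 < 1 - t by lra.
  rewrite {}ez in hz *; rewrite /bern_cgf mulr1 lnK ?posrE; last first.
    by rewrite divr_gt0 ?mulr_gt0.
  have -> : 1 - t + t * ((1 - t) / (t * (expR eta - 1))) =
      (t * expR eta) * ((1 - t) / (t * (expR eta - 1))).
    by field; rewrite !gt_eqF.
  rewrite lnM ?posrE ?divr_gt0 ?mulr_gt0 ?expR_gt0//.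
  rewrite lnM ?posrE ?expR_gt0// expRK.
  move: hz; rewrite /bern subrr mul0r addr0 mul1r divr1.
  lra.
have infA : has_inf A by split; [exists z0|exists t => z [/andP[]]].
have lb z : A z -> inf A <= z by move=> Az; apply: ge_inf => //; exact: infA.2.
have tz0 : t <= z0 by case: Az0 => /andP[].
have L0 : 0 <= tilt t z0 by rewrite tilt_ge0// tz0.
have L1 : 0 < 1 + tilt t z0 by lra.
(* Keeping z1 <= z0 bounds the slope [tilt t z1] by [tilt t z0], so a point within eta / (1 +
   [tilt t z0]) of the infimum loses at most eta along its line. *)
have [z1 [Az1 z1i z1z0]] : exists z1,
    [/\ A z1, z1 <= inf A + eta / (1 + tilt t z0) & z1 <= z0].
  have [z1 Az1 z1i] := inf_adherent (divr_gt0 eta0 L1) infA.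
  have [le|lt] := leP z1 z0; first by exists z1; split => //; exact: ltW.
  by exists z0; split => //; rewrite ltW// (lt_trans lt).
have [/andP[tz1 _] hz1] := Az1.
have z11 : z1 < 1 by exact: le_lt_trans z01.
have z1g : 0 < z1 by exact: lt_le_trans tz1.
exists (tilt t z1) => z tz hz.
have zi : inf A <= z by exact: lb.
have := tiltE (z := z1) t01; rewrite z1g z11 => /(_ isT) eq1.
have l0 : 0 <= tilt t z1 by rewrite tilt_ge0// tz1.
have le1 : tilt t z1 * (z1 - z) <= eta.
  have [zz|zz] := leP z1 z.
    by rewrite (le_trans _ (ltW eta0))// mulr_ge0_le0// subr_le0.
  have l1 : tilt t z1 <= 1 + tilt t z0.
    by rewrite (le_trans (tilt_homo (z' := z0) _ _ _ _))//; lra.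
  apply: (le_trans (y := (1 + tilt t z0) * (eta / (1 + tilt t z0)))).
    by apply: ler_pM => //; lra.
  by rewrite mulrCA divff ?mulr1// gt_eqF.
lra.
Qed.

(** The reflection z -> 1 - z carries this to [upper_tilt] and changes the sign of lam. *)
Lemma lower_tilt t r eta : 0 < t < 1 -> 0 < eta ->
  exists lam, forall z, 0 <= z <= t -> bern z t <= - r ->
    r - eta <= lam * z - bern_cgf t lam.
Proof.
move=> t01 eta0; have t01' : 0 < 1 - t < 1 by lra.
have [lam hlam] := @upper_tilt (1 - t) r eta t01' eta0.
exists (- lam) => z zt hz; rewrite bern_cgfN//.
have := hlam (1 - z); rewrite bern_sym => /(_ _ hz).
have : 1 - t <= 1 - z <= 1 by lra.
move=> -> /(_ isT); lra.
Qed.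

(** The first term of [bern] is exactly - x ln(1 + eps); ln y <= y - 1 bounds the second by x eps /
    (1 + eps). *)
Lemma bern_shrink_le x eps : 0 < eps -> 0 < x <= 1 ->
  bern x (x / (1 + eps)) <= - (x * (ln (1 + eps) - eps / (1 + eps))).
Proof.
move=> e0 /andP[x0 x1]; have e1 : 0 < 1 + eps by lra.
have t1 : x / (1 + eps) < 1 by rewrite ltr_pdivrMr//; lra.
rewrite /bern.
have -> : x / (1 + eps) / x = (1 + eps)^-1 by field; rewrite !gt_eqF.
rewrite lnV ?posrE//.
have : (1 - x) * ln ((1 - x / (1 + eps)) / (1 - x)) <=
   (1 - x / (1 + eps)) - (1 - x).
  by apply: mul_ln_div_le; lra.
have -> : (1 - x / (1 + eps)) - (1 - x) = x * (eps / (1 + eps)).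
  by field; rewrite gt_eqF.
lra.
Qed.

Lemma shrink_gap_gt0 eps : 0 < eps -> 0 < ln (1 + eps) - eps / (1 + eps).
Proof.
move=> e0; have e1 : 0 < 1 + eps by lra.
have q0 : 0 < (1 + eps)^-1 by rewrite invr_gt0.
have q1 : (1 + eps)^-1 < 1 by rewrite invf_lt1//; lra.
have -> : eps / (1 + eps) = 1 - (1 + eps)^-1 by field; rewrite gt_eqF.
set q := (1 + eps)^-1 in q0 q1 *.
have -> : 1 + eps = q^-1 by rewrite invrK.
rewrite lnV ?posrE//.
(* The square root s of q makes the tangent bound strict: ln q = 2 ln s <= 2 (s - 1) < s^2 - 1 = q -
   1. *)
have s0 : 0 < Num.sqrt q by rewrite sqrtr_gt0.
have sq : Num.sqrt q ^+ 2 = q by rewrite sqr_sqrtr ?ltW.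
move: (Num.sqrt q) s0 sq => s s0 sq.
have := ln_le_sub1 s0.
have s1 : s != 1 by apply/eqP => h; move: q1; rewrite -sq h expr1n ltxx.
rewrite -sq lnXn// mulr2n.
have : 0 < (s - 1) ^+ 2 by rewrite exprn_even_gt0//= subr_eq0.
rewrite !expr2; lra.
Qed.

End bern.

(** * Comparison of the relative entropies on the two sides of the sample mean *)

Section reflect.
Variable R : realType.
Implicit Types (s t u c : R).

(** [bern (t * (1 + c * u)) t] with its logarithms split, ready to be differentiated in u; c is 1 or
    -1. *)
Let g c t u : R := - (t * ((1 + c * u) * ln (1 + c * u)))
  + (1 - t * (1 + c * u)) * (ln (1 - t) - ln (1 - t * (1 + c * u))).

Let gE c t u : 0 < t < 1 -> 0 < 1 + c * u -> t * (1 + c * u) < 1 ->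
  bern (t * (1 + c * u)) t = g c t u.
Proof.
move=> /andP[t0 t1] a0 b0.
rewrite /bern /g -(ln_div (x := 1 - t)) ?posrE; [|lra|lra].
have -> : t / (t * (1 + c * u)) = (1 + c * u)^-1 by field; rewrite !gt_eqF.
by rewrite lnV ?posrE//; ring.
Qed.

Let is_derive_g c t u : 0 < t < 1 -> 0 < 1 + c * u -> t * (1 + c * u) < 1 ->
  is_derive u 1 (g c t)
    (- (c * t) * (ln (1 + c * u) + ln (1 - t) - ln (1 - t * (1 + c * u)))).
Proof.
move=> /andP[t0 t1] a0 b0.
have b0' : 0 < 1 - t * (1 + c * u) by lra.
have Da : is_derive u 1 (fun u : R => 1 + c * u) c.
  by apply: is_derive_eq; rewrite /GRing.scale/=; ring.
have Db : is_derive u 1 (fun u : R => 1 - t * (1 + c * u)) (- (c * t)).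
  by apply: is_derive_eq; rewrite /GRing.scale/=; ring.
have Dla : is_derive u 1 (fun u : R => ln (1 + c * u)) ((1 + c * u)^-1 * c).
  by have ? := is_derive1_ln a0; exact: is_derive1_comp.
have Dlb : is_derive u 1 (fun u : R => ln (1 - t * (1 + c * u)))
    ((1 - t * (1 + c * u))^-1 * - (c * t)).
  by have ? := is_derive1_ln b0'; exact: is_derive1_comp.
rewrite /g; apply: is_derive_eq.
by rewrite /GRing.scale/=; field; rewrite !gt_eqF.
Qed.

(** Both sides vanish at u = 0 and their difference G has a nonnegative derivative: ln(1 + v) + ln(1
    - v) <= 0, and s t e <= s - t yields (1 - t)(1 - s) <= (1 - t (1 + v))(1 - s (1 - v)). It is
    applied with t = x / (1 + eps) and s = x / (1 - eps). *)
Lemma bern_reflect s t u e : 0 < t -> t <= s -> s < 1 -> t * (1 + e) < 1 ->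
  s * t * e <= s - t -> e < 1 -> 0 <= u <= e ->
  bern (s * (1 - u)) s <= bern (t * (1 + u)) t.
Proof.
move=> t0 ts s1 te ste e1 /andP[u0 ue].
have s0 : 0 < s by lra.
have aux v : 0 <= v <= u -> [/\ 0 < 1 + 1 * v, t * (1 + 1 * v) < 1,
    0 < 1 + -1 * v & s * (1 + -1 * v) < 1].
  move=> /andP[v0 vu]; split; [lra| |lra|].
    by apply: le_lt_trans te; rewrite ler_pM2l//; lra.
  by apply: le_lt_trans s1; rewrite ler_piMr//; lra.
pose G v := g 1 t v - g (-1) s v.
have DG v : 0 <= v <= u -> is_derive v 1 G
  (- (1 * t) * (ln (1 + 1 * v) + ln (1 - t) - ln (1 - t * (1 + 1 * v)))
   - (- (-1 * s) *
      (ln (1 + -1 * v) + ln (1 - s) - ln (1 - s * (1 + -1 * v))))).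
  move=> hv; have [h1 h2 h3 h4] := aux v hv.
  by apply: is_deriveB; apply: is_derive_g => //; lra.
have oc v : v \in `]0, u[%R -> 0 <= v <= u.
  by rewrite in_itv/= => /andP[v0 vu]; rewrite !ltW.
have : G 0 <= G u.
  apply: (@ger0_derive1_ndecr _ G 0 u) => //.
  - by move=> v /oc/DG[].
  - move=> v /oc hv; have [h1 h2 h3 h4] := aux v hv.
    rewrite derive1E; have [_ ->] := DG v hv.
    have /andP[v0 vu] := hv.
    have hA : ln (1 + 1 * v) + ln (1 + -1 * v) <= 0.
      rewrite -lnM ?posrE// ln_le0//.
      have : 0 <= v * v by rewrite mulr_ge0.
      lra.
    have hA0 : 0 <= ln (1 + 1 * v) by rewrite ln_ge0//; lra.
    have p1 : 0 < 1 - t * (1 + 1 * v) by lra.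
    have p2 : 0 < 1 - s * (1 + -1 * v) by lra.
    have p3 : 0 < 1 - t by lra.
    have p4 : 0 < 1 - s by lra.
    have tv : 0 <= t * v by apply: mulr_ge0 => //; exact: ltW.
    have hB0 : ln (1 - t * (1 + 1 * v)) <= ln (1 - t).
      by rewrite ler_ln ?posrE//; lra.
    have hB : ln (1 - t) + ln (1 - s) <=
        ln (1 - t * (1 + 1 * v)) + ln (1 - s * (1 + -1 * v)).
      rewrite -!lnM ?posrE// ler_ln ?posrE ?mulr_gt0// -subr_ge0.
      have -> : (1 - t * (1 + 1 * v)) * (1 - s * (1 + -1 * v)) -
         (1 - t) * (1 - s) = v * (s - t - s * t * v) by ring.
      rewrite mulr_ge0// subr_ge0 (le_trans _ ste)// ler_wpM2l//; last lra.
      by apply: mulr_ge0; exact: ltW.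
    set a := ln (1 + 1 * v) in hA hA0 *.
    set a' := ln (1 + -1 * v) in hA *.
    set b := ln (1 - t) in hB0 hB *; set b' := ln (1 - s) in hB *.
    set c := ln (1 - t * (1 + 1 * v)) in hB0 hB *.
    set c' := ln (1 - s * (1 + -1 * v)) in hB *.
    (* The factor a + b - c is nonnegative by [hA0] and [hB0]; [hA] and [hB] compare it with c' - a'
       - b'. *)
    have k1 : t * (a + b - c) <= s * (a + b - c) by rewrite ler_wpM2r//; lra.
    have k2 : s * (a + b - c) <= s * (c' - a' - b') by rewrite ler_pM2l//; lra.
    lra.
  - by apply: derivable_within_continuous => v; rewrite in_itv/= => /DG[].
have [h1 h2 h3 h4] : [/\ 0 < 1 + 1 * u, t * (1 + 1 * u) < 1,
    0 < 1 + -1 * u & s * (1 + -1 * u) < 1] by apply: aux; rewrite u0 lexx.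
have -> : G 0 = 0.
  rewrite /G /g !mulr0 !addr0 !mulr1 ln1 !subrr.
  by rewrite !(mulr0, mul0r, oppr0, addr0).
have := gE (c := 1) (t := t) (u := u); rewrite mul1r => gt.
have := gE (c := -1) (t := s) (u := u); rewrite mulN1r => gs.
rewrite gt ?gs /G ?subr_ge0//; lra.
Qed.

End reflect.

(** At z = 0 or z = 1 the degenerate logarithm has coefficient 0. This quotient-free form serves the
    measurability of the stopping rule. *)
Lemma bern_lnB (R : realType) (z t : R) : 0 <= z <= 1 -> 0 < t < 1 ->
  bern z t = z * (ln t - ln z) + (1 - z) * (ln (1 - t) - ln (1 - z)).
Proof.
move=> /andP[z0 z1] /andP[t0 t1]; rewrite /bern; congr (_ + _).
  have [->|zn0] := eqVneq z 0; first by rewrite !mul0r.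
  by rewrite ln_div// posrE lt_neqAle eq_sym zn0.
have [->|zn1] := eqVneq z 1; first by rewrite subrr !mul0r.
by rewrite ln_div// posrE subr_gt0// lt_neqAle zn1.
Qed.

(** * Ville's inequality for the tilted sums *)

Section independence.
Local Open Scope ereal_scope.
Context d d1 d2 (T : measurableType d) (T1 : measurableType d1)
  (T2 : measurableType d2) (R : realType) (P : probability T R).

Definition mpair (U : {mfun T >-> T1}) (V : {mfun T >-> T2}) (w : T) : T1 * T2 :=
  (U w, V w).

Let measurable_mpair U V : measurable_fun setT (mpair U V).
Proof. exact: measurable_fun_pair. Qed.

HB.instance Definition _ U V :=
  isMeasurableFun.Build _ _ _ _ (mpair U V) (measurable_mpair U V).

(** As functions of C, both sides are finite measures on the product space that agree on rectangles,
    a generating class stable under intersection. *)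
Lemma pair_event_independence (U : {mfun T >-> T1}) (V : {mfun T >-> T2})
    (D : set T) :
  measurable D ->
  (forall A B, measurable A -> measurable B ->
    P (U @^-1` A `&` V @^-1` B `&` D) = P (U @^-1` A `&` V @^-1` B) * P D) ->
  forall C : set (T1 * T2), measurable C ->
    P (mpair U V @^-1` C `&` D) =
    P (mpair U V @^-1` C) * P D.
Proof.
move=> mD indep C mC.
pose r : {nonneg R} := NngNum (fine_ge0 (measure_ge0 P D)).
pose G := [set C : set (T1 * T2) |
  exists A B, [/\ measurable A, measurable B & C = A `*` B]].
have rE : r%:num%:E = P D by rewrite /= fineK// fin_num_measure.
rewrite muleC -rE.
apply: (@measure_unique _ R _ G (fun=> setT) _ _ _ _
  (pushforward (mrestr P mD) (mpair U V))
  (mscale r (pushforward P (mpair U V)))) => //.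
- rewrite measurable_prod_measurableType; congr (<<s _ >>).
  apply/seteqP; split=> [E [A mA [B mB <-]]|E [A [B [mA mB ->]]]].
    by exists A, B.
  by exists A => //; exists B.
- move=> _ _ [A [B [mA mB ->]]] [A' [B' [mA' mB' ->]]].
  exists (A `&` A'), (B `&` B'); split; [exact: measurableI..|].
  by rewrite setXI.
- by move=> _; exists setT, setT; split => //; rewrite setXTT.
- by rewrite bigcup_const//; exists 0%N.
- move=> _ [A [B [mA mB ->]]].
  have := indep A B mA mB; rewrite muleC -rE; exact.
- move=> _; apply: le_lt_trans (ltry 1); apply: probability_le1.
  by apply: measurableI => //; rewrite preimage_setT.
Qed.

(** Independence identifies the law of the pair with the product measure; Tonelli's theorem does the
    rest. *)
Lemma independent_integral (U : {mfun T >-> T1}) (V : {mfun T >-> T2})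
    (f : T1 * T2 -> \bar R) :
  (forall A B, measurable A -> measurable B ->
    P (U @^-1` A `&` V @^-1` B) = P (U @^-1` A) * P (V @^-1` B)) ->
  measurable_fun setT f -> (forall y, 0 <= f y) ->
  \int[P]_w f (U w, V w) =
  \int[distribution P U]_u \int[distribution P V]_v f (u, v).
Proof.
move=> indep mf f0.
rewrite -(@fubini_tonelli1 _ _ _ _ _ (distribution P U) (distribution P V) f)//.
transitivity (\int[distribution P (mpair U V)]_y f y).
  by rewrite ge0_integral_distribution.
apply: eq_measure_integral => C mC _.
by apply/esym/product_measure_unique => // A B mA mB; rewrite -indep.
Qed.

End independence.

(** * Recursive processes driven by independent inputs *)

Section recursive_process.
Context d (T : measurableType d) (R : realType) (P : probability T R).
Variables (X : nat -> {RV P >-> R}) (F : (R * R)%type -> R) (r0 : R).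
Hypothesis mF : measurable_fun [set: (R * R)%type] F.

Fixpoint process (n : nat) (w : T) : R :=
  if n is k.+1 then F (process k w, X k w) else r0.

Lemma measurable_process n : measurable_fun setT (process n).
Proof.
elim: n => [|n IH]; first exact: measurable_cst.
apply: (measurableT_comp mF (g := fun w => (process n w, X n w))).
exact: measurable_fun_pair.
Qed.

HB.instance Definition _ n :=
  isMeasurableFun.Build _ _ _ _ (process n) (measurable_process n).

Lemma bigcap_seq_cons (s : seq nat) (n : nat) (E : nat -> set T) :
  \bigcap_(i in [set` n :: s]) E i = E n `&` \bigcap_(i in [set` s]) E i.
Proof. by rewrite !bigcap_seq big_cons. Qed.

Hypothesis X_indep : mutually_independent X.

(** Induction on n for all s at once: the next state is a function of ([process n], [X n]), and the
    induction hypothesis for s enlarged by n makes this pair independent of the later inputs. *)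
Lemma process_independent n (s : seq nat) (A : set R) (B : nat -> set R) :
  uniq s -> (forall i, i \in s -> (n <= i)%N) -> measurable A ->
  (forall i, measurable (B i)) ->
  P (process n @^-1` A `&` \bigcap_(i in [set` s]) (X i @^-1` B i)) =
  (P (process n @^-1` A) * P (\bigcap_(i in [set` s]) (X i @^-1` B i)))%E.
Proof.
elim: n s A B => [|n IH] s A B us sn mA mB.
  have [Ar0|Ar0] := pselect (A r0).
    have -> : process 0 @^-1` A = setT by apply/seteqP; split.
    by rewrite setTI probability_setT mul1e.
  have -> : process 0 @^-1` A = set0 by apply/seteqP; split.
  by rewrite set0I measure0 mul0e.
set D := \bigcap_(i in _) _.
have mXB i C : measurable C -> measurable (X i @^-1` C).
  by move=> mC; rewrite -[_ @^-1` _]setTI; exact: measurable_funP.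
have mD : measurable D.
  rewrite /D bigcap_seq; apply: bigsetI_measurable => i _; exact: mXB.
have nns : n \notin s by apply/negP => /sn; rewrite ltnn.
have IHs (C E : set R) : measurable C -> measurable E ->
    (P (process n @^-1` C `&` X n @^-1` E `&` D) =
    P (process n @^-1` C `&` X n @^-1` E) * P D)%E.
  move=> mC mE.
  (* Inserting E at index n lets [X n] join the family indexed by s. *)
  pose B' i := if i == n then E else B i.
  have mB' i : measurable (B' i) by rewrite /B'; case: ifP.
  have DE : D = \bigcap_(i in [set` s]) (X i @^-1` B' i).
    apply: eq_bigcapr => i /= is_.
    by rewrite /B'; case: eqP => // ni; rewrite -ni is_ in nns.
  have B'n : B' n = E by rewrite /B' eqxx.
  have un : uniq (n :: s) by rewrite /= nns.
  have -> : P (process n @^-1` C `&` X n @^-1` E `&` D) =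
      (P (process n @^-1` C) * P (X n @^-1` E `&` D))%E.
    rewrite DE -B'n -setIA -bigcap_seq_cons IH// => i.
    by rewrite inE => /predU1P[->//|/sn/ltnW].
  have -> : P (process n @^-1` C `&` X n @^-1` E) =
      (P (process n @^-1` C) * P (X n @^-1` E))%E.
    have := IH [:: n] C B' isT _ mC mB'.
    rewrite bigcap_seq big_seq1 B'n; apply=> i.
    by rewrite inE => /eqP ->.
  have -> : P (X n @^-1` E `&` D) = (P (X n @^-1` E) * P D)%E.
    by rewrite DE -B'n -bigcap_seq_cons !X_indep// big_cons.
  by rewrite muleA.
have mFA : measurable (F @^-1` A).
  by rewrite -[X in measurable X]setTI; exact: mF.
exact: (pair_event_independence mD IHs mFA).
Qed.

End recursive_process.

Lemma measurable_superlevel d (T : measurableType d) (R : realType)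
    (f : T -> R) (c : R) :
  measurable_fun setT f -> measurable [set w | c <= f w].
Proof.
move=> mf; have := mf measurableT _ (measurable_itv `[c, +oo[).
rewrite setTI; congr measurable.
by apply/seteqP; split=> w /=; rewrite in_itv/= andbT.
Qed.

(** * The exponential supermartingale and its maximal inequality *)

Section exponential_supermartingale.
Context d (T : measurableType d) (R : realType) (P : probability T R).
Variables (X : nat -> {RV P >-> R}) (mu : R).
Hypothesis X_indep : mutually_independent X.
Hypothesis X_bounded : forall i w, 0 <= X i w <= 1.
Hypothesis X_mean : forall i, ('E_P[X i] = mu%:E)%E.
Hypothesis mu01 : 0 < mu < 1.
Variables (lam c : R).
Hypothesis c0 : 0 < c.

Let gain (x : R) : R := expR (lam * x - bern_cgf mu lam).

(** Convexity of exp, read off [bern_cgf_ge] with x as the Bernoulli mean; that lemma needs 0 < x <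
    1, so the endpoints are treated apart. *)
Let gain_chord x : 0 <= x <= 1 ->
  gain x <= (1 - x + x * expR lam) / expR (bern_cgf mu lam).
Proof.
move=> /andP[x0 x1]; rewrite /gain expRD expRN ler_pM2r ?invr_gt0 ?expR_gt0//.
have [->|x0'] := eqVneq x 0; first by rewrite mulr0 mul0r subr0 addr0 expR0.
have [->|x1'] := eqVneq x 1; first by rewrite mulr1 mul1r subrr add0r.
have x01 : 0 < x < 1 by rewrite !lt_neqAle x0 x1 x1' eq_sym x0'.
rewrite -[leRHS]lnK ?posrE ?bern_cgf_arg_gt0// ler_expR.
exact: bern_cgf_ge.
Qed.

Let measurable_gain : measurable_fun setT gain.
Proof.
by apply: measurableT_comp => //; exact: measurable_funB.
Qed.

(** The chord is affine in x, so its mean depends on mu only and equals e^phi(lam), which is the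
    normalization. *)
Let gain_mean i : (\int[P]_w (gain (X i w))%:E <= 1)%E.
Proof.
pose e := expR (bern_cgf mu lam); have e0 : 0 < e by exact: expR_gt0.
have mX : measurable_fun setT (X i) by [].
have Xi : (\int[P]_w (X i w)%:E = mu%:E)%E by rewrite -expectation_def.
apply: (@le_trans _ _ (\int[P]_w (e^-1 * (1 - X i w + X i w * expR lam))%:E)%E).
  apply: ge0_le_integral => //.
  - by move=> w _; rewrite lee_fin expR_ge0.
  - by apply/measurable_EFinP; exact: measurableT_comp.
  - apply/measurable_EFinP; apply: measurable_funM => //.
    apply: measurable_funD; first exact: measurable_funB.
    exact: measurable_funM.
  - by move=> w _; rewrite lee_fin mulrC gain_chord.
have iX : P.-integrable setT (EFin \o X i).
  apply/integrableP; split; first exact/measurable_EFinP.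
  under eq_integral => w _ do
    rewrite gee0_abs ?lee_fin ?(andP (X_bounded i w)).1//.
  by rewrite Xi ltry.
under eq_integral => w _.
  have -> : (e^-1 * (1 - X i w + X i w * expR lam))%:E =
      ((e^-1)%:E + ((expR lam - 1) / e)%:E * (X i w)%:E)%E.
    by rewrite -EFinM -EFinD; congr EFin; ring.
  over.
rewrite integralD//; last 2 first.
- exact: finite_measure_integrable_cst.
- exact: integrableZl.
rewrite integral_cst//= probability_setT mule1 integralZl// Xi -EFinM -EFinD.
rewrite lee_fin /e /bern_cgf lnK ?posrE ?bern_cgf_arg_gt0//.
rewrite le_eqVlt; apply/predU1P; left; field.
by rewrite gt_eqF// bern_cgf_arg_gt0.
Qed.

(* The process driven by F is the exponential one frozen once it reaches c; the
   absolute value makes F nonnegative everywhere, as Tonelli's theorem needs. *)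
Let F (y : (R * R)%type) : R := `|y.1| * (if c <= y.1 then 1 else gain y.2).

Let mF : measurable_fun [set: (R * R)%type] F.
Proof.
apply: measurable_funM; first exact: measurableT_comp.
apply: measurable_fun_ifT => //=.
  exact: measurable_fun_ler.
exact: measurableT_comp.
Qed.

Let W := process X F 1.

Let F_mean u i : (\int[distribution P (X i)]_v (F (u, v))%:E <= `|u|%:E)%E.
Proof.
rewrite ge0_integral_distribution//=; last 2 first.
- apply/measurable_EFinP.
  exact: (measurableT_comp mF (pair1_measurable u)).
- by move=> v; rewrite lee_fin mulr_ge0//; case: ifP => //; rewrite expR_ge0.
rewrite /F/=; case: (c <= u).
  by rewrite mulr1 integral_cst//= probability_setT mule1.
under eq_integral do rewrite EFinM.
rewrite ge0_integralZl//.
- by rewrite -[leRHS]mule1 lee_wpmul2l.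
- by apply/measurable_EFinP; exact: measurableT_comp.
- by move=> w _; rewrite lee_fin expR_ge0.
Qed.

(** The supermartingale step: [W n] is independent of [X n], so one may integrate over [X n] first
    and apply [F_mean]. *)
Let W_mean n : (\int[P]_w `|W n w|%:E <= 1)%E.
Proof.
elim: n => [|n IH].
  by rewrite /W/= normr1 integral_cst//= mul1e probability_setT.
apply: le_trans IH.
have F0 y : (0 <= (F y)%:E)%E.
  by rewrite lee_fin mulr_ge0//; case: ifP => //; rewrite expR_ge0.
have -> : (\int[P]_w `|W n.+1 w|%:E = \int[P]_w (F (W n w, X n w))%:E)%E.
  by apply: eq_integral => w _; rewrite ger0_norm//= -lee_fin.
have indep A B : measurable A -> measurable B ->
    (P (W n @^-1` A `&` X n @^-1` B) = P (W n @^-1` A) * P (X n @^-1` B))%E.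
  move=> mA mB.
  have := @process_independent _ _ _ _ X F 1 mF X_indep n [:: n] A (fun=> B).
  rewrite bigcap_seq big_seq1; apply => // i.
  by rewrite inE => /eqP ->.
rewrite (independent_integral (f := EFin \o F) indep) //=; last first.
  exact/measurable_EFinP.
apply: (@le_trans _ _ (\int[distribution P (W n)]_u `|u|%:E)%E).
  apply: ge0_le_integral => //=.
  - by move=> u _; apply: integral_ge0 => v _.
  - have mEF : measurable_fun [set: (R * R)%type] (EFin \o F).
      exact/measurable_EFinP.
    exact: (@measurable_fun_fubini_tonelli_F _ _ _ _ R (distribution P (X n))
      _ mEF F0).
  - by apply/measurable_EFinP; exact: normr_measurable.
rewrite ge0_integral_distribution//.
by apply/measurable_EFinP; exact: normr_measurable.
Qed.

Let M n w : R := expR (lam * \sum_(i < n) X i w - n%:R * bern_cgf mu lam).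

Let M_crossing n w : c <= M n w -> c <= W n w.
Proof.
(* Until it is frozen, W coincides with M; afterwards it stays at or above c. *)
suff [//|->//] : c <= W n w \/ W n w = M n w.
elim: n => [|n IH].
  by right; rewrite /M big_ord0 mulr0 mul0r subrr expR0.
rewrite /W /= -/W /F /=; case: ifPn => [cW|cW].
  by left; rewrite mulr1 (le_trans cW)// ler_norm.
case: IH => [cW'|WM]; first by rewrite cW' in cW.
right; rewrite WM ger0_norm ?expR_ge0// /M /gain -expRD; congr expR.
by rewrite big_ord_recr/= -natr1; ring.
Qed.

Let W_stopped n k w : (n <= k)%N -> c <= W n w -> c <= W k w.
Proof.
move=> /subnK <-; elim: (k - n)%N => // j IH cW; rewrite addSn /W /= -/W /F /=.
by rewrite IH// mulr1 (le_trans (IH cW))// ler_norm.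
Qed.

(** Freezing makes the events c <= [W n] increase with n, so the probability of their union is a
    limit of probabilities that Markov's inequality bounds by 1 / c. *)
Lemma ville_inequality :
  (P (\bigcup_n [set w | (c <= M n w)%R]) <= (c^-1)%:E)%E.
Proof.
pose E n := [set w | c <= W n w].
have mE n : measurable (E n).
  by apply: measurable_superlevel; exact: measurable_process.
have mM n : measurable_fun setT (M n).
  apply: measurableT_comp => //; apply: measurable_funB => //.
  apply: measurable_funM => //; exact: measurable_sum.
apply: (@le_trans _ _ (P (\bigcup_n E n))).
  apply: le_measure; rewrite ?inE.
  - by apply: bigcup_measurable => n _; exact: measurable_superlevel.
  - exact: bigcup_measurable.
  - by move=> w [n _ cM]; exists n => //; exact: M_crossing.
have Ecvg : P (E n) @[n --> \oo] --> P (\bigcup_n E n).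
  apply: (nondecreasing_cvg_mu (mu := P)) => //; first exact: bigcup_measurable.
  by move=> n k nk; apply/subsetPset => w; exact: W_stopped.
rewrite -(cvg_lim _ Ecvg)//; apply: lime_le.
  by apply/cvg_ex; eexists; exact: Ecvg.
apply: nearW => n.
rewrite -[leRHS]mul1e lee_pdivlMr// muleC.
apply: le_trans (W_mean n).
have mW : measurable_fun setT (fun w => `|W n w|).
  apply: measurableT_comp => //; exact: measurable_process.
have mk : (c%:E * P [set x | c%:E <= `|(W n x)%:E|] <=
    \int[P]_w `|W n w|%:E)%E.
  by have := @markov _ _ _ P (W n) id c c0; rewrite unlock; exact.
apply: le_trans mk; rewrite lee_pmul2l ?lte_fin//.
apply: le_measure; rewrite ?inE.
- exact: mE.
- by under eq_set do rewrite abse_EFin lee_fin; exact: measurable_superlevel.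
- by move=> w /= cW; rewrite lee_fin (le_trans cW)// ler_norm.
Qed.

End exponential_supermartingale.

Lemma crossing_probability_le d (T : measurableType d) (R : realType)
    (P : probability T R) (X : nat -> {RV P >-> R}) (mu lam L : R) :
  mutually_independent X -> (forall i w, 0 <= X i w <= 1) ->
  (forall i, 'E_P[X i] = mu%:E)%E -> 0 < mu < 1 ->
  (P (\bigcup_n [set w |
     (L <= lam * \sum_(i < n) X i w - n%:R * bern_cgf mu lam)%R])
   <= (expR (- L))%:E)%E.
Proof.
move=> Xi Xb Xm mu01.
rewrite expRN; have := ville_inequality Xi Xb Xm mu01 lam (expR_gt0 L).
by under eq_bigcupr do under eq_set do rewrite ler_expR.
Qed.

(** * The stopping rule *)

Section stopping_boundary.
Variable R : realType.
Implicit Types (x z t mu eps a b r lam L : R).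

Lemma M_B_bern z t : 0 <= z <= 1 -> 0 < t < 1 -> M_B z t = (bern z t)%:E.
Proof.
move=> /andP[z0 z1] t01; rewrite /M_B t01/= /bern.
have [->|zn0] := eqVneq z 0; first by rewrite mul0r add0r !subr0 mul1r divr1.
have [->|zn1] := eqVneq z 1; first by rewrite subrr mul0r addr0 mul1r divr1.
by rewrite !lt_neqAle z0 z1 zn1 eq_sym zn0.
Qed.

(** For y between mu and x, the pair (y + a (x - y), y) mixes (mu + a (x - mu), mu) with (x, x) in
    the proportion b, so [bern_mix] applies. *)
Lemma bern_toward mu x a y b : 0 < mu < 1 -> 0 <= x <= 1 -> 0 <= a <= 1 ->
  0 <= b < 1 -> y = (1 - b) * mu + b * x ->
  bern (mu + a * (x - mu)) mu <= bern (y + a * (x - y)) y.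
Proof.
move=> /[dup] mu01 /andP[mu0 mu1] /[dup] x01 /andP[x0 x1] /andP[a0 a1] b01 ->.
have z01 : 0 <= mu + a * (x - mu) <= 1.
  have -> : mu + a * (x - mu) = (1 - a) * mu + a * x by ring.
  rewrite addr_ge0 ?mulr_ge0 ?subr_ge0 ?(ltW mu0)//=.
  have : (1 - a) * mu <= (1 - a) * 1 by apply: ler_wpM2l; lra.
  have : a * x <= a * 1 by exact: ler_wpM2l.
  lra.
have := bern_mix b01 x01 z01 mu01.
congr (_ <= bern _ _); ring.
Qed.

Lemma bad_stop mu x eps a r : 0 < mu < 1 -> 0 < eps < 1 -> 0 < x <= 1 ->
  0 <= a <= 1 -> eps * mu <= `|x - mu| ->
  (M_B (x / (1 + eps) * (1 + a * eps)) (x / (1 + eps)) <= (- r)%:E)%E ->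
  bern (mu + a * (x - mu)) mu <= - r.
Proof.
move=> /[dup] mu01 /andP[mu0 mu1] /andP[e0 e1] /andP[x0 x1].
move=> /[dup] a01 /andP[a0 a1] dev.
have x01 : 0 <= x <= 1 by rewrite ltW.
have e1' : 0 < 1 + eps by lra.
set t := x / (1 + eps).
have xt : x = t * (1 + eps) by rewrite /t; field; rewrite gt_eqF.
have t0 : 0 < t by rewrite divr_gt0.
have te : 0 < t * eps by rewrite mulr_gt0.
have t1 : t < 1 by lra.
have ae : a * eps <= eps by rewrite ler_piMl// ltW.
have ae0 : 0 <= a * eps by rewrite mulr_ge0// ltW.
have tae : t * (a * eps) <= t * eps by rewrite ler_pM2l.
have tae0 : 0 <= t * (a * eps) by rewrite mulr_ge0// ltW.
rewrite M_B_bern; [|lra|lra]; rewrite lee_fin; apply: le_trans.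
have [mux|xmu] := leP mu x.
  (* The deviation means x >= (1 + eps) mu, which places t between mu and x. *)
  have mut : mu <= t.
    move: dev; rewrite ger0_norm ?subr_ge0// => dev.
    by rewrite /t ler_pdivlMr//; lra.
  have mux' : 0 < x - mu by lra.
  have -> : t * (1 + a * eps) = t + a * (x - t) by rewrite xt; ring.
  apply: (bern_toward (b := (t - mu) / (x - mu))) => //.
    rewrite divr_ge0 ?subr_ge0//= ltr_pdivrMr//; lra.
  by field; rewrite gt_eqF.
have e1'' : 0 < 1 - eps by lra.
(* Below mu, t lies on the far side of x from mu; s lies between x and mu because x <= (1 - eps)
   mu. *)
pose s := x / (1 - eps).
have xs : x = s * (1 - eps) by rewrite /s; field; rewrite gt_eqF.
have s0 : 0 < s by rewrite divr_gt0.
have se : 0 < s * eps by rewrite mulr_gt0.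
have smu : s <= mu.
  move: dev; rewrite ler0_norm ?subr_le0 ?(ltW xmu)// => dev.
  by rewrite /s ler_pdivrMr//; lra.
have xmu' : 0 < mu - x by lra.
apply: (@le_trans _ _ (bern (s * (1 - a * eps)) s)).
  have -> : s * (1 - a * eps) = s + a * (x - s) by rewrite xs; ring.
  apply: (bern_toward (b := (mu - s) / (mu - x))) => //.
    rewrite divr_ge0 ?subr_ge0 ?(ltW xmu)//= ltr_pdivrMr//; lra.
  by field; rewrite gt_eqF.
apply: (@bern_reflect _ s t (a * eps) eps) => //; try lra.
(* Since s (1 - eps) = x = t (1 + eps), s - t equals (s + t) eps. *)
- have : s * t * eps <= (s + t) * eps.
    rewrite ler_pM2r//.
    have : s * t <= s * 1 by rewrite ler_pM2l//; lra.
    lra.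
  lra.
Qed.

(* Before time m the slack is Jensen's inequality; after it, nonnegativity of
   the exponent K. *)
Lemma tilted_sum_ge mu lam x (n m : nat) : 0 < mu < 1 -> (0 < m)%N ->
  let K := lam * (mu + n%:R / (maxn n m)%:R * (x - mu)) - bern_cgf mu lam in
  0 <= K -> m%:R * K <= lam * (n%:R * x) - n%:R * bern_cgf mu lam.
Proof.
move=> mu01 m0 K K0.
have m0' : 0 < m%:R :> R by rewrite ltr0n.
have [mn|nm] := leqP m n.
  have n0 : 0 < n%:R :> R by rewrite ltr0n (leq_trans m0).
  have -> : lam * (n%:R * x) - n%:R * bern_cgf mu lam = n%:R * K.
    by rewrite /K (maxn_idPl mn) divff ?gt_eqF//; ring.
  by rewrite ler_wpM2r// ler_nat.
have jensen : 0 <= (m%:R - n%:R) * (bern_cgf mu lam - lam * mu).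
  by rewrite mulr_ge0 ?subr_ge0 ?ler_nat ?(ltnW nm)// bern_cgf_ge.
suff -> : m%:R * K = lam * (n%:R * x) - n%:R * bern_cgf mu lam -
    (m%:R - n%:R) * (bern_cgf mu lam - lam * mu) by lra.
by rewrite /K (maxn_idPr (ltnW nm)); field; rewrite gt_eqF.
Qed.

(** After reflection 1 - t is 1 - z divided by 1 + e, so strictness comes from [shrink_gap_gt0]. *)
Lemma bern_lt0 z t : 0 < z -> z < t -> t < 1 -> bern z t < 0.
Proof.
move=> z0 zt t1; rewrite -bern_sym.
have t1' : 0 < 1 - t by lra.
pose e := (t - z) / (1 - t); have e0 : 0 < e by rewrite divr_gt0 ?subr_gt0.
have -> : 1 - t = (1 - z) / (1 + e).
  by rewrite /e; field; rewrite !gt_eqF//; lra.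
apply: le_lt_trans (bern_shrink_le e0 _) _; first by lra.
by rewrite oppr_lt0 mulr_gt0 ?shrink_gap_gt0//; lra.
Qed.

Lemma tilt_le0 t z : 0 < t < 1 -> 0 < z <= t -> tilt t z <= 0.
Proof.
move=> t01 /andP[z0 zt]; have /andP[t0 t1] := t01.
apply: le_trans (tilt_homo t01 z0 zt t1) _.
by rewrite /tilt mulrC mulrC divff ?ln1// gt_eqF// mulr_gt0// subr_gt0.
Qed.

End stopping_boundary.

(** * Measurability, error events and termination of the sampling plan *)

Section sampling_plan.
Context d (T : measurableType d) (R : realType) (P : probability T R).
Variables (X : nat -> {RV P >-> R}) (mu eps : R).
Hypothesis X_bounded : forall i w, 0 <= X i w <= 1.
Hypothesis mu01 : 0 < mu < 1.
Hypothesis eps01 : 0 < eps < 1.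

Let eps1 : 0 < 1 + eps. Proof. by case/andP: eps01 => e0 _; lra. Qed.

Lemma sample_mean_range n w : 0 <= sample_mean X n w <= 1.
Proof.
have S0 : 0 <= \sum_(i < n) X i w.
  by apply: sumr_ge0 => i _; case/andP: (X_bounded i w).
have S1 : \sum_(i < n) X i w <= n%:R.
  have -> : n%:R = \sum_(i < n) 1 :> R by rewrite sumr_const card_ord.
  by apply: ler_sum => i _; case/andP: (X_bounded i w).
rewrite /sample_mean; apply/andP; split; first by rewrite mulr_ge0.
have [->|n0] := eqVneq n 0%N; first by rewrite invr0 mul0r.
by rewrite mulrC ler_pdivrMr ?mul1r// ltr0n lt0n.
Qed.

Lemma measurable_sample_mean n : measurable_fun setT (sample_mean X n).
Proof. by apply: measurable_funM => //; exact: measurable_sum. Qed.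

Lemma stop_ratio_range (n k : nat) : 0 <= (n%:R / (maxn n k)%:R : R) <= 1.
Proof.
rewrite divr_ge0//=; have [->|n0] := eqVneq n 0%N; first by rewrite mul0r.
rewrite ler_pdivrMr ?mul1r ?ler_nat ?leq_maxl//.
by rewrite ltr0n (leq_trans _ (leq_maxl _ _))// lt0n.
Qed.

Lemma stop_args_range x (a : R) : 0 < x <= 1 -> 0 <= a <= 1 ->
  0 <= x / (1 + eps) * (1 + a * eps) <= 1 /\ 0 < x / (1 + eps) < 1.
Proof.
case/andP: eps01 => e0 e1 /andP[x0 x1] /andP[a0 a1].
have t0 : 0 < x / (1 + eps) by rewrite divr_gt0.
have ae : a * eps <= eps by rewrite ler_piMl// ltW.
have ae0 : 0 <= a * eps by rewrite mulr_ge0// ltW.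
split; last by rewrite t0 ltr_pdivrMr//; lra.
apply/andP; split; first by rewrite mulr_ge0 ?(ltW t0)//; lra.
apply: le_trans x1; rewrite -[leRHS](@divfK _ (1 + eps)) ?gt_eqF//.
by rewrite ler_pM2l//; lra.
Qed.

Variables (dl : nat -> R) (m : nat -> nat) (N : set nat).

Lemma measurable_stop_at n : measurable [set w | stop_at X eps dl m N w n].
Proof.
have [Nn|Nn] := pselect (N n); last first.
  have -> : [set w | stop_at X eps dl m N w n] = set0.
    by apply/seteqP; split=> // w [].
  exact: measurable0.
pose z l w : R := sample_mean X n w / (1 + eps)
  * (1 + n%:R / (maxn n (m l))%:R * eps).
pose t w : R := sample_mean X n w / (1 + eps).
(* Minus the tested entropy expression, so that stopping through l becomes a superlevel set of a
   measurable real function. *)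
pose g l w := - (z l w * (ln (t w) - ln (z l w))
  + (1 - z l w) * (ln (1 - t w) - ln (1 - z l w))).
have aE l : n%:R * eps / (maxn n (m l))%:R = n%:R / (maxn n (m l))%:R * eps.
  by rewrite mulrAC.
have mS := measurable_sample_mean n.
have mt : measurable_fun setT t by exact: measurable_funM.
have mz l : measurable_fun setT (z l) by exact: measurable_funM.
have mln (f : T -> R) : measurable_fun setT f ->
    measurable_fun setT (fun w => ln (f w)).
  by move=> mf; exact: (measurableT_comp (@measurable_ln R) mf).
have mg l : measurable_fun setT (g l).
  apply: measurableT_comp => //; apply: measurable_funD.
    by apply: measurable_funM => //; apply: measurable_funB; exact: mln.
  apply: measurable_funM; first exact: measurable_funB.
  by apply: measurable_funB; apply: mln; exact: measurable_funB.
have -> : [set w | stop_at X eps dl m N w n] =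
    ~` [set w | 0 <= - sample_mean X n w] `&`
    \bigcup_l [set w | - ((m l)%:R^-1 * ln (dl l / 2)) <= g l w].
  apply/seteqP; split=> w /=.
    move=> [_ x0 [l hl]]; split; first by apply/negP; rewrite oppr_ge0 -ltNge.
    exists l => //=; rewrite lerN2.
    have /andP[_ x1] := sample_mean_range n w.
    have [|z01 t01] := @stop_args_range (sample_mean X n w)
      (n%:R / (maxn n (m l))%:R) _ (stop_ratio_range n (m l)).
      by rewrite x0.
    by move: hl; rewrite aE M_B_bern// lee_fin bern_lnB.
  move=> [/negP]; rewrite oppr_ge0 -ltNge => x0 [l _ /=]; rewrite lerN2 => hl.
  split => //; exists l.
  have /andP[_ x1] := sample_mean_range n w.
  have [|z01 t01] := @stop_args_range (sample_mean X n w)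
    (n%:R / (maxn n (m l))%:R) _ (stop_ratio_range n (m l)).
    by rewrite x0.
  by rewrite aE M_B_bern// lee_fin bern_lnB.
apply: measurableI.
  apply: measurableC; apply: measurable_superlevel; exact: measurableT_comp.
by apply: bigcup_measurable => l _; exact: measurable_superlevel.
Qed.

Hypothesis X_indep : mutually_independent X.
Hypothesis X_mean : forall i, ('E_P[X i] = mu%:E)%E.
Hypothesis dl_pos : forall l, 0 < dl l.
Hypothesis m_pos : forall l, (0 < m l)%N.

Let crossing (lam L : R) := \bigcup_n [set w |
  (L <= lam * \sum_(i < n) X i w - n%:R * bern_cgf mu lam)%R].

Let measurable_crossing lam L : measurable (crossing lam L).
Proof.
apply: bigcup_measurable => n _; apply: measurable_superlevel.
apply: measurable_funB => //; apply: measurable_funM => //.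
exact: measurable_sum.
Qed.

Lemma sum_sample_mean n w : (0 < n)%N ->
  \sum_(i < n) X i w = n%:R * sample_mean X n w.
Proof. by move=> n0; rewrite /sample_mean mulVKf// pnatr_eq0 -lt0n. Qed.

Lemma crossingP lam L l n w : (0 < n)%N ->
  L <= (m l)%:R * (lam * (mu + n%:R / (maxn n (m l))%:R
    * (sample_mean X n w - mu)) - bern_cgf mu lam) ->
  crossing lam L w.
Proof.
move=> n0; set K := (_ - bern_cgf _ _) => LK.
have [K0|K0] := leP 0 K.
  exists n => //=; rewrite (le_trans LK)// sum_sample_mean//.
  exact: tilted_sum_ge.
(* A negative K forces L <= 0, and the empty sum at time 0 already reaches L. *)
exists 0%N => //=; rewrite big_ord0 mulr0 mul0r subrr (le_trans LK)//.
by rewrite mulr_ge0_le0// ltW.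
Qed.

(** One tilt per side of mu serves every n, so a single E covers all bad stops through l. The loss
    eta = ln kappa / m_l in the exponent inflates each of the two crossing bounds dl_l / 2 by the
    factor kappa. *)
Lemma bad_stop_event l kappa : 1 < kappa ->
  exists2 E, measurable E /\ (P E <= (kappa * dl l)%:E)%E &
  forall n w, (0 < n)%N -> 0 < sample_mean X n w ->
    eps * mu <= `|sample_mean X n w - mu| ->
    (M_B (sample_mean X n w / (1 + eps) * (1 + n%:R * eps / (maxn n (m l))%:R))
         (sample_mean X n w / (1 + eps))
     <= ((m l)%:R^-1 * ln (dl l / 2))%:E)%E -> E w.
Proof.
move=> k1; pose r := - ((m l)%:R^-1 * ln (dl l / 2)).
have m0 : 0 < (m l)%:R :> R by rewrite ltr0n.
pose eta := ln kappa / (m l)%:R.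
have eta0 : 0 < eta by rewrite divr_gt0// ln_gt0.
have k0 : 0 < kappa by lra.
have d2 : 0 < dl l / 2 by rewrite divr_gt0.
have [lu hu] := @upper_tilt R mu r eta mu01 eta0.
have [ld hd] := @lower_tilt R mu r eta mu01 eta0.
pose L := (m l)%:R * (r - eta).
have eL : expR (- L) = kappa * dl l / 2.
  have -> : - L = ln kappa + ln (dl l / 2).
    by rewrite /L /r /eta; field; rewrite gt_eqF.
  by rewrite -lnM ?posrE// lnK ?posrE ?mulr_gt0// mulrA.
exists (crossing lu L `|` crossing ld L); first split.
- exact: measurableU.
- apply: le_trans (measureU2 _ _ _) _ => //.
  apply: (@le_trans _ _ ((expR (- L))%:E + (expR (- L))%:E)%E).
    by apply: leeD; exact: crossing_probability_le.
  by rewrite eL -EFinD lee_fin -splitr.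
move=> n w n0 x0 dev hM.
have /andP[_ x1] := sample_mean_range n w.
have a01 := stop_ratio_range n (m l); have /andP[a0 a1] := a01.
set x := sample_mean X n w in x0 x1 dev hM.
set a := n%:R / (maxn n (m l))%:R in a01 a0 a1.
have hb : bern (mu + a * (x - mu)) mu <= - r.
  apply: (@bad_stop _ mu x eps) => //; first by rewrite x0.
  by rewrite /r opprK /a [_ / _ * eps]mulrAC.
have /andP[mu0 mu1] := mu01.
have cross lam : r - eta <= lam * (mu + a * (x - mu)) - bern_cgf mu lam ->
    crossing lam L w.
  by move=> h; apply: (@crossingP _ _ l n) => //; rewrite ler_pM2l.
have [mux|xmu] := leP mu x.
  left; apply: cross; apply: hu => //.
  have : 0 <= a * (x - mu) by rewrite mulr_ge0// subr_ge0.
  have : a * (x - mu) <= x - mu by rewrite ler_piMl// subr_ge0.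
  lra.
right; apply: cross; apply: hd => //.
have : 0 <= a * (mu - x) by rewrite mulr_ge0// subr_ge0 ltW.
have : a * (mu - x) <= mu - x by rewrite ler_piMl// subr_ge0 ltW.
lra.
Qed.

Hypothesis m_incr : forall l, (m l < m l.+1)%N.
Hypothesis dl_m_lim : (fun l : nat => ln (dl l) / (m l)%:R) @ \oo --> (0 : R).
Hypothesis N_m : forall l, N (m l).

Let Stop := [set w | exists n, stop_at X eps dl m N w n].

Let measurable_Stop : measurable Stop.
Proof.
have -> : Stop = \bigcup_n [set w | stop_at X eps dl m N w n].
  by apply/seteqP; split=> [w [n h]|w [n _ h]]; exists n.
by apply: bigcup_measurable => n _; exact: measurable_stop_at.
Qed.

Lemma m_ge l : (l <= m l)%N.
Proof. by elim: l => // l IH; exact: leq_ltn_trans (m_incr l). Qed.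

Lemma stop_cost_cvg0 :
  (fun l => (m l)%:R^-1 * ln (dl l / 2)) @ \oo --> (0 : R).
Proof.
have -> : (fun l => (m l)%:R^-1 * ln (dl l / 2)) =
    (fun l => ln (dl l) / (m l)%:R - ln 2 / (m l)%:R).
  by apply/funext => l; rewrite ln_div ?posrE// mulrC mulrBl.
rewrite -[X in _ --> X](subrr 0); apply: cvgB => //.
rewrite -[X in _ --> X](mulr0 (ln 2)); apply: cvgMr.
apply/gtr0_cvgV0; first by near=> l; rewrite ltr0n.
apply/cvgryPge => A; near=> l.
apply: (@le_trans _ _ l%:R); last by rewrite ler_nat m_ge.
by near: l; exact: nbhs_infty_ger.
Unshelve. all: by end_near. Qed.

Lemma stop_almost_surely : P Stop = 1%E.
Proof.
have /andP[mu0 mu1] := mu01; have /andP[e0 e1] := eps01.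
pose c := ln (1 + eps) - eps / (1 + eps).
have c0 : 0 < c by exact: shrink_gap_gt0.
pose K := - bern (mu / 2) mu.
have K0 : 0 < K by rewrite oppr_gt0 bern_lt0//; lra.
(* The tilt for the lower tail at mu / 2, with exponential rate K. *)
pose lam := tilt mu (mu / 2).
have lam0 : lam <= 0 by rewrite tilt_le0//; lra.
have lamE : lam * (mu / 2) - bern_cgf mu lam = K by rewrite tiltE//; lra.
suff : (P (~` Stop) <= 0)%E.
  rewrite probability_setC// => h.
  apply/eqP; rewrite eq_le probability_le1//=; move: h.
  rewrite -(fineK (fin_num_measure P _ measurable_Stop)) -EFinB !lee_fin; lra.
apply/lee_addgt0Pr => e e0'; rewrite add0e.
near \oo => l.
have m0 : 0 < (m l)%:R :> R by rewrite ltr0n.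
(* This crossing has probability at most e^(- m_l K), which is below any positive bound for large
   l. *)
apply: (@le_trans _ _ (P (crossing lam ((m l)%:R * K)))); last first.
  apply: le_trans (crossing_probability_le _ _ _ _ _ _) _ => //.
  rewrite lee_fin -[leRHS]lnK ?posrE// ler_expR lerNl -ler_pdivrMr//.
  apply: (@le_trans _ _ l%:R); last by rewrite ler_nat m_ge.
  near: l; exact: nbhs_infty_ger.
apply: le_measure; rewrite ?inE.
- exact: measurableC.
- exact: measurable_crossing.
move=> w /= nstop; apply: contrapT => ncross; apply: nstop; exists (m l).
have /andP[x0 x1] := sample_mean_range (m l) w.
(* As lam <= 0, a sample mean of at most mu / 2 at time m_l would produce the crossing. *)
have xmu : mu / 2 < sample_mean X (m l) w.
  rewrite ltNge; apply/negP => xmu; apply: ncross.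
  apply: (@crossingP _ _ l (m l)) => //.
  rewrite maxnn divff ?gt_eqF// mul1r addrCA subrr addr0 ler_pM2l// -lamE.
  by rewrite lerD2r ler_wnM2l.
have x0' : 0 < sample_mean X (m l) w by lra.
split => //; exists l.
(* At n = m_l the ratio n / (n \/ m_l) is 1, so the first tested argument is the sample mean
   itself. *)
rewrite maxnn [_ * eps / _]mulrAC divff ?gt_eqF// mul1r divfK ?gt_eqF//.
have [||_ t01] := @stop_args_range (sample_mean X (m l) w) 1.
- by rewrite x0'.
- by rewrite ler01 lexx.
rewrite M_B_bern ?x0//.
rewrite lee_fin; apply: le_trans (bern_shrink_le e0 _) _; first by rewrite x0'.
apply: (@le_trans _ _ (- (mu / 2 * c))).
  by rewrite lerN2 ler_pM2r// ltW.
near: l.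
have : - (mu / 2 * c) < 0 by rewrite oppr_lt0 mulr_gt0// divr_gt0.
move/(cvgr_gt (0 : R) stop_cost_cvg0); apply: filterS => l; exact: ltW.
Unshelve. all: by end_near. Qed.

Lemma good_event_probability (delta : R) : 0 < delta ->
  series dl @ \oo --> delta -> (forall n, N n -> (0 < n)%N) ->
  ((1 - delta)%:E <= P [set w | exists n, stops_first_at X eps dl m N w n /\
     (`|sample_mean X n w - mu| < eps * mu)%R])%E.
Proof.
move=> delta0 dl_sum N_pos; set Good := [set w | _].
have mGood : measurable Good.
  (* Decompose by the stopping time: a stop at n, none before n, and a small deviation there. *)
  have -> : Good = \bigcup_n (([set w | stop_at X eps dl m N w n] `&`
      \bigcap_(k in [set k | (k < n)%N]) ~` [set w | stop_at X eps dl m N w k])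
      `\` [set w | eps * mu <= `|sample_mean X n w - mu|]).
    apply/seteqP; split=> w /=.
      move=> [n [[sn first] dev]]; exists n => //; split; last first.
        by apply/negP; rewrite -ltNge.
      split => // k /= kn sk.
      by have := first k sk; rewrite leqNgt kn.
    move=> [n _ [[sn first] /negP dev]]; exists n; split; last by rewrite ltNge.
    split => // k sk; rewrite leqNgt; apply/negP => kn.
    exact: (first k kn).
  apply: bigcup_measurable => n _; apply: measurableD.
    apply: measurableI; first exact: measurable_stop_at.
    apply: bigcap_measurableType => k _.
    apply: measurableC; exact: measurable_stop_at.
  apply: measurable_superlevel; apply: measurableT_comp => //.
  apply: measurable_funB => //; exact: measurable_sample_mean.
have [p pE] : exists p, P Good = p%:E.
  by exists (fine (P Good)); rewrite fineK// fin_num_measure.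
rewrite pE lee_fin; apply/ler_addgt0Pr => e e0.
(* Chosen so that kappa delta = delta + e, the bound for the union of the bad events. *)
pose kappa := 1 + e / delta.
have k1 : 1 < kappa by rewrite ltrDl divr_gt0.
have /choice[E hE] : forall l, exists E, (measurable E /\
    (P E <= (kappa * dl l)%:E)%E) /\
  forall n w, (0 < n)%N -> 0 < sample_mean X n w ->
    eps * mu <= `|sample_mean X n w - mu| ->
    (M_B (sample_mean X n w / (1 + eps) * (1 + n%:R * eps / (maxn n (m l))%:R))
         (sample_mean X n w / (1 + eps))
     <= ((m l)%:R^-1 * ln (dl l / 2))%:E)%E -> E w.
  by move=> l; have [E h1 h2] := bad_stop_event l k1; exists E.
have mE l : measurable (E l) by case: (hE l) => -[].
pose Bad := \bigcup_l E l.
have mBad : measurable Bad by exact: bigcup_measurable.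
have PBad : (P Bad <= (delta + e)%:E)%E.
  apply: le_trans (measure_sigma_subadditive P mE mBad (fun _ => id)) _.
  apply: (@le_trans _ _ (\sum_(l <oo) (kappa * dl l)%:E)%E).
    by apply: lee_nneseries => // l _; case: (hE l) => -[].
  have scvg : (\sum_(0 <= l < n) (kappa * dl l)%:E)%E @[n --> \oo] -->
      (kappa * delta)%:E.
    under eq_fun do rewrite sumEFin -mulr_sumr.
    by apply: cvg_EFin; [exact: nearW|apply: cvgMr; exact: dl_sum].
  rewrite (cvg_lim _ scvg)// lee_fin.
  by rewrite /kappa mulrDl mul1r divfK// gt_eqF.
have StopGood : Stop `\` Bad `<=` Good.
  move=> w [[n0 sn0] nbad].
  have exs : exists n, `[< stop_at X eps dl m N w n >].
    by exists n0; exact/asboolP.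
  have [n /asboolP sn first] := ex_minnP exs.
  exists n; split.
    by split => // k sk; apply: first; exact/asboolP.
  rewrite ltNge; apply/negP => dev; apply: nbad.
  have [Nn x0 [l hl]] := sn; exists l => //.
  have [_ hw] := hE l; exact: (hw n w (N_pos _ Nn) x0 dev hl).
(* The almost sure event [Stop] is covered by [Good] and [Bad]. *)
have h1 : (1 <= P Good + P Bad)%E.
  rewrite -stop_almost_surely.
  apply: le_trans (measureU2 _ _ _) => //.
  apply: le_measure; rewrite ?inE//; first exact: measurableU.
  move=> w sw; have [bw|nbw] := pselect (Bad w); first by right.
  by left; apply: StopGood.
have : (1 <= P Good + (delta + e)%:E)%E by apply: le_trans h1 _; exact: leeD2l.
rewrite pE -EFinD lee_fin; lra.
Qed.

End sampling_plan.

Theorem mainTheorem3 (d : measure_display) (T : measurableType d)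
    (R : realType) (P : probability T R) (X : nat -> {RV P >-> R})
    (mu eps delta : R) (dl : nat -> R) (m : nat -> nat) (N : set nat)
    (X_iid : iid X)
    (X_bounded : forall (i : nat) (w : T), 0 <= X i w <= 1)
    (X_mean : forall i : nat, ('E_P[X i] = mu%:E)%E)
    (mu_range : 0 < mu < 1)
    (eps_range : 0 < eps < 1)
    (delta_range : 0 < delta < 1)
    (dl_pos : forall l : nat, 0 < dl l)
    (dl_sum : series dl @ \oo --> delta)
    (m_pos : forall l : nat, (0 < m l)%N)
    (m_incr : forall l : nat, (m l < m l.+1)%N)
    (dl_m_lim : (fun l : nat => ln (dl l) / (m l)%:R) @ \oo --> (0 : R))
    (N_pos : forall n : nat, N n -> (0 < n)%N)
    (N_m : forall l : nat, N (m l)) :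
  P [set w | exists n : nat, stop_at X eps dl m N w n] = 1%E /\
  (P [set w | exists n : nat,
       stops_first_at X eps dl m N w n /\
       (`|sample_mean X n w - mu| < eps * mu)%R]
   >= (1 - delta)%:E)%E.
Proof.
have [X_indep _] := X_iid; have /andP[delta0 _] := delta_range.
split; first by apply: (stop_almost_surely X_bounded mu_range).
exact: good_event_probability.
Qed.
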